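(* Let $\mathcal{G}$ be a second countable, Hausdorff, locally compact, totally disconnected topological group, let $T:\mathcal{G}\to\mathcal{G}$ be a continuous group automorphism, and let $\mathcal{H}$ be a compact, open subgroup of $\mathcal{G}$ whose coset partition is memoryless. If the points with compact $T$-orbit closure are dense in $\mathcal{G}$, then $(\Sigma_{\mathcal{G}/\mathcal{H}},\sigma)$ is topologically conjugate to the product of a full-shift on a finite alphabet and a permutation of a countable discrete set where every orbit is finite, and the scale of $T$ is $s(T)=1$.
   Context: The scale of $T$ is $s(T)=\min\{[T(\mathcal{L}):T(\mathcal{L})\cap\mathcal{L}]\}$, the minimum over all compact, open subgroups $\mathcal{L}$ of $\mathcal{G}$. Regard the countable set of left cosets $\mathcal{G}/\mathcal{H}$ as a discrete alphabet and define the coding map $\pi:\mathcal{G}\to(\mathcal{G}/\mathcal{H})^{\mathbb{Z}}$ by $\pi(x)_j=T^j(x)\mathcal{H}$ (the coset itinerary of $x$). The coset partition of $\mathcal{H}$ is memoryless if $\pi(\mathcal{G})$ (with the shift $\sigma(x)_i=x_{i+1}$ and the topology induced from the product topology) is a one-step, locally compact, countable state Markov shift, i.e. it consists of all sequences of cosets whose consecutive pairs are allowed, a pair $(x\mathcal{H},y\mathcal{H})$ being allowed iff $T(x\mathcal{H})\cap y\mathcal{H}\ne\emptyset$. In that case $\Sigma_{\mathcal{G}/\mathcal{H}}$ denotes $\pi(\mathcal{G})$. The full-shift on a finite alphabet $A$ is $A^{\mathbb{Z}}$ with the product topology and the shift. *)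

(* Defs.v *)
From HB Require Import structures.
From mathcomp Require Import all_boot all_order all_algebra.
From mathcomp Require Import all_classical all_reals all_analysis.

Set Implicit Arguments.
Unset Strict Implicit.
Unset Printing Implicit Defensive.

Local Open Scope classical_set_scope.
Local Open Scope card_scope.
Local Open Scope group_scope.

HB.mixin Record isTopologicalGroup G of Topological G & Group G := {
  mulg_continuous : continuous (fun xy : G * G => xy.1 * xy.2) ;
  invg_continuous : continuous (fun x : G => x^-1)
}.

#[short(type="topologicalGroupType")]
HB.structure Definition TopologicalGroup :=
  {G of Topological G & Group G & isTopologicalGroup G}.

(* For bijective f this is the j-th iterate of f, for every j : int. Otherwise
   'pinv_id is only a partial inverse and negative j are not meaningful. *)
Definition iterz (X : choiceType) (f : X -> X) (j : int) : X -> X :=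
  match j with
  | Posz n => iter n f
  | Negz n => iter n.+1 ('pinv_id [set: X] f)
  end.

Definition orbitz (X : choiceType) (f : X -> X) (x : X) : set X :=
  [set iterz f j x | j in [set: int]].

Section Cosets.
Context {G : groupType}.

Definition subgroup (H : set G) : Prop := group_closed (mem H).

Definition lcoset (H : set G) (x : G) : set G := [set x * h | h in H].

Definition cosets (H : set G) : set (set G) := [set lcoset H x | x in [set: G]].

Definition to_coset (H : set G) (x : G) : cosets H :=
  exist _ (lcoset H x) (mem_set (imageT (lcoset H) x)).

(* [M : K] = n for a subgroup M and a subgroup K of M. *)
Definition index_eq (M K : set G) (n : nat) : Prop :=
  [set lcoset K x | x in M] #= `I_n.
End Cosets.

Section Scale.
Context {G : topologicalGroupType}.

(* The finite values of [T(L) : T(L) `&` L], L a compact open subgroup. *)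
Definition displacement_index (T : G -> G) : set nat :=
  [set n | exists L : set G, [/\ subgroup L, compact L, open L &
     index_eq (T @` L) (T @` L `&` L) n]].

(* `get` returns 0 on the empty set, and an index is never 0. *)
Definition scale (T : G -> G) : nat :=
  get [set n | displacement_index T n /\
               forall m, displacement_index T m -> (n <= m)%N].
End Scale.

Notation full_shift A := {ptws int -> discrete_topology A}.

Section Shifts.
Local Open Scope ring_scope.

Definition shiftz (A : choiceType) (s : full_shift A) : full_shift A :=
  fun j => s (j + 1).

Definition markov_shift (A : choiceType) (allowed : A -> A -> Prop) :
    set (full_shift A) :=
  [set s | forall j, allowed (s j) (s (j + 1))].

Definition topologically_conjugate (X Y : topologicalType)
    (f : X -> X) (g : Y -> Y) : Prop :=
  exists (h : X -> Y) (k : Y -> X),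
    [/\ cancel h k, cancel k h, continuous h, continuous k &
        forall x, h (f x) = g (h x)].
End Shifts.

Section Coding.
Context {G : topologicalGroupType}.
Variables (T : G -> G) (H : set G).

Definition coding (x : G) : full_shift (cosets H) :=
  fun j => to_coset H (iterz T j x).

(* As a type, coded_shift carries the subspace topology (set_type) of the
   product of the discrete topologies on cosets H. *)
Definition coded_shift : set (full_shift (cosets H)) :=
  [set coding x | x in [set: G]].

Definition allowed (a b : cosets H) : Prop :=
  (T @` set_val a) `&` set_val b !=set0.

Definition memoryless : Prop :=
  [/\ coded_shift = markov_shift allowed,
      locally_compact [set: coded_shift] &
      countable [set: cosets H]].

Lemma iterzS (bijT : bijective T) (j : int) (x : G) :
  iterz T j (T x) = iterz T (j + 1)%R x.
Proof.
have TK : cancel T ('pinv_id [set: G] T).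
  by move=> y; apply: pinvKV; rewrite ?inE // => ? ? _ _; apply: bij_inj.
case: j => [n|[|n]]; rewrite /iterz.
- by rewrite (_ : (Posz n + 1)%R = Posz n.+1) ?iterSr // -PoszD addn1.
- by rewrite /= TK.
- have -> : (Negz n.+1 + 1)%R = Negz n.
    by rewrite !NegzE -[n.+2]addn1 PoszD GRing.opprD GRing.addrNK.
  by rewrite [LHS]iterSr TK.
Qed.

Lemma shift_coded (bijT : bijective T) (s : full_shift (cosets H)) :
  s \in coded_shift -> shiftz s \in coded_shift.
Proof.
rewrite !inE => -[x _ <-]; exists (T x) => //.
by apply/funext => j; rewrite /coding /shiftz iterzS.
Qed.

(* The shift restricted to coded_shift, which is invariant when T is
   bijective. *)
Definition coded_map (bijT : bijective T) (s : coded_shift) : coded_shift :=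
  exist _ (shiftz (set_val s)) (shift_coded bijT (valP s)).
End Coding.

Arguments coding {G} T H x.
Arguments coded_shift {G} T H.
Arguments allowed {G} T H a b.
Arguments coded_map {G} T H bijT s.

(* Main.v *)
Require Import Defs.
From mathcomp Require Import all_boot all_order all_algebra.
From mathcomp Require Import all_classical all_reals all_analysis.

Set Implicit Arguments.
Unset Strict Implicit.
Unset Printing Implicit Defensive.

Local Open Scope classical_set_scope.
Local Open Scope group_scope.

(** The bounded points being dense, an argument in the style of Willis shows
    that the homoclinic points [L] (those entering [H] under both iterations)
    satisfy [U H = L H = V H], where [U] and [V] are the points entering [H]
    in the past and in the future: a bounded point of [U] revisits a coset of
    [H], and memorylessness ([H] is the product of [stays S H] and
    [stays T H], [S] being the inverse of [T]) splits the return as an element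
    of [stays S H] times a homoclinic one.
    As [L] is covered by finitely many cosets, [M = L H] is a compact open
    subgroup with [T M = M]; hence the scale is 1, and [T] permutes [G/M] with
    finite orbits.

    Inside [M] let [C] be the pointwise stabiliser of [M/H] and let
    [Q_0 = 1], [Q_(i+1) = T^-1 (Q_i C)]. These are normal in [M], and
    [Q_r H = M] for some [r]. A section of [G -> G/H] adapted to the chain
    [Q_i H] labels the outgoing edges of every coset by the same finite
    alphabet [T H / H] in such a way that reading a common letter turns
    equivalence modulo [Q_(i+1) H] into equivalence modulo [Q_i H]. So a word
    of [r] letters and a coset of [M] determine a coset of [H]: the labelling
    together with the class in [G/M] is the conjugacy. *)

(** * Left cosets and finite covers by cosets *)

Section CosetRelation.
Context {G : groupType}.
Implicit Types (H Q M : set G) (x y z : G).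

(** For a subgroup [H] this is equality of the left cosets of [x] and [y], kept as a relation on
    points so that cosets are seldom handled as sets. *)
Definition eqm H x y : Prop := H (x^-1 * y).

Lemma sub1g H : subgroup H -> H 1.
Proof. by case=> /set_mem. Qed.

Lemma subMg H x y : subgroup H -> H x -> H y -> H (x * y).
Proof. by move=> /group_closedM sH Hx Hy; apply/set_mem/sH; apply/mem_set. Qed.

Lemma subVg H x : subgroup H -> H x -> H x^-1.
Proof. by move=> /group_closedV sH Hx; apply/set_mem/sH; apply/mem_set. Qed.

Lemma subgroupP H : H 1 -> (forall x y, H x -> H y -> H (x * y)) ->
  (forall x, H x -> H x^-1) -> subgroup H.
Proof.
move=> H1 HM HV; split; first exact/mem_set.
by move=> x y /set_mem Hx /set_mem Hy; apply/mem_set/HM => //; apply: HV.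
Qed.

Lemma subgroupI H K : subgroup H -> subgroup K -> subgroup (H `&` K).
Proof.
move=> sH sK; apply: subgroupP => [|x y [Hx Kx] [Hy Ky]|x [Hx Kx]]; split;
  by [apply: sub1g|apply: subMg|apply: subVg].
Qed.

Lemma eqmxx H x : subgroup H -> eqm H x x.
Proof. by move=> sH; rewrite /eqm mulVg; apply: sub1g. Qed.

Lemma eqm_sym H x y : subgroup H -> eqm H x y -> eqm H y x.
Proof. by move=> sH /(subVg sH); rewrite invgM invgK. Qed.

Lemma eqm_trans H y x z : subgroup H -> eqm H x y -> eqm H y z -> eqm H x z.
Proof. by move=> sH xy /(subMg sH xy); rewrite mulgA mulgK. Qed.

Lemma eqm_mull H g x y : eqm H (g * x) (g * y) <-> eqm H x y.
Proof. by rewrite /eqm invgM -mulgA mulKg. Qed.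

Lemma eqm_mulr H x h : H h -> eqm H x (x * h).
Proof. by rewrite /eqm mulKg. Qed.

Lemma eqm1 H x : eqm H 1 x <-> H x.
Proof. by rewrite /eqm invg1 mul1g. Qed.

Lemma eqmP H x y : eqm H x y -> exists2 h, H h & y = x * h.
Proof. by move=> xy; exists (x^-1 * y) => //; rewrite mulVKg. Qed.

Lemma eqm_mem H M x y : subgroup M -> H `<=` M -> M x -> eqm H x y -> M y.
Proof. by move=> sM HM Mx /eqmP[h /HM Mh ->]; apply: subMg. Qed.

Lemma lcoset_eq H x y : subgroup H -> lcoset H x = lcoset H y <-> eqm H x y.
Proof.
move=> sH; split=> [exy|xy].
  have : lcoset H y y by exists 1; [exact: sub1g|rewrite mulg1].
  by rewrite -exy => -[h Hh <-]; apply: eqm_mulr.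
have lcosetP z w : lcoset H z w <-> eqm H z w.
  by split=> [[h Hh <-]|/eqmP[h Hh ->]]; [exact: eqm_mulr|exists h].
apply/seteqP; split=> w /lcosetP zw; apply/lcosetP; apply: eqm_trans zw => //.
exact: eqm_sym.
Qed.

(** Algebraic substitute for compactness of [Q], relative to the open subgroup [H]. The
    representatives in [s] may lie outside [Q]. *)
Definition fincov H Q : Prop :=
  exists s : seq G, forall x, Q x -> exists2 y, y \in s & eqm H y x.

Lemma fincovS H Q1 Q2 : Q1 `<=` Q2 -> fincov H Q2 -> fincov H Q1.
Proof. by move=> Q12 [s sP]; exists s => x /Q12/sP. Qed.

Lemma fincov_bigcup H (T : eqType) (s : seq T) (Q : T -> set G) :
  (forall t, t \in s -> fincov H (Q t)) ->
  fincov H [set x | exists2 t, t \in s & Q t x].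
Proof.
elim: s => [_|t s ih Qs]; first by exists [::] => x [].
have [|s1 s1P] := ih; first by move=> u us; apply: Qs; rewrite inE us orbT.
have [|s2 s2P] := Qs t; first by rewrite mem_head.
exists (s1 ++ s2) => x [u]; rewrite inE => /orP[/eqP->|us] Qx.
  by have [y ys yx] := s2P _ Qx; exists y => //; rewrite mem_cat ys orbT.
have [|y ys yx] := s1P x; first by exists u.
by exists y => //; rewrite mem_cat ys.
Qed.

Lemma fincov_pigeonhole H Q (g : nat -> G) : subgroup H -> fincov H Q ->
  (forall n, Q (g n)) -> exists a b, (a < b)%N /\ eqm H (g a) (g b).
Proof.
move=> sH [s sP] Qg; pose f n := sval (cid2 (sP _ (Qg n))).
have fs n : f n \in s by rewrite /f; case: cid2.
have fg n : eqm H (f n) (g n) by rewrite /f; case: cid2.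
(* The first [(size s).+1] values of [f] all lie in [s], so [f] cannot be injective there. *)
have [inj|] := pselect {in iota 0 (size s).+1 &, injective f}.
  have := uniq_leq_size (s1 := map f (iota 0 (size s).+1)) (s2 := s).
  rewrite map_inj_in_uniq // iota_uniq size_map size_iota ltnn => /(_ isT) F.
  by suff: false by []; apply: F => y /mapP[n _ ->].
move=> /existsNP[a] /existsNP[b] /not_implyP[_] /not_implyP[_].
move=> /not_implyP[fab ab].
have gab : eqm H (g a) (g b).
  by apply: eqm_trans (fg b) => //; rewrite -fab; apply: eqm_sym.
have [lt_ab|lt_ba|//] := ltngtP a b; first by exists a, b.
by exists b, a; split=> //; apply: eqm_sym.
Qed.

(** Turns pointwise bounds into a uniform one: [P n] depends only on the coset and grows with [n],
    so the largest of finitely many thresholds serves all of [Q]. *)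
Lemma fincov_bound H Q (P : nat -> G -> Prop) : subgroup H -> fincov H Q ->
  (forall m n x, (m <= n)%N -> P m x -> P n x) ->
  (forall m x y, P m x -> eqm H x y -> P m y) ->
  (forall x, Q x -> exists n, P n x) ->
  exists n, forall x, Q x -> P n x.
Proof.
move=> sH [s sP] Pmono PH Pex.
suff [n nP] : exists n, forall y, y \in s -> (exists m, P m y) -> P n y.
  exists n => x Qx; have [y ys yx] := sP x Qx.
  apply: (PH _ _ _ _ yx); apply: nP => //.
  have [m Pm] := Pex x Qx; exists m; apply: PH Pm _; exact: eqm_sym.
elim: s {sP} => [|y s [n nP]]; first by exists 0%N.
have [[m Pm]|nPy] := pselect (exists m, P m y).
  exists (maxn m n) => z; rewrite inE => /orP[/eqP-> _|zs Pz].
    by apply: Pmono Pm; rewrite leq_maxl.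
  by apply: (Pmono n); rewrite ?leq_maxr //; apply: nP.
exists n => z; rewrite inE => /orP[/eqP-> //|zs Pz]; exact: nP.
Qed.

(** Each [H]-coset meeting [Q] is given a representative inside [Q], because the hypothesis compares
    only points of [Q]. *)
Lemma fincov_refine H K Q : subgroup H ->
  (forall x y, Q x -> Q y -> eqm H x y -> eqm K x y) ->
  fincov H Q -> fincov K Q.
Proof.
move=> sH QHK [s sP]; exists [seq xget y [set x | Q x /\ eqm H y x] | y <- s].
move=> x Qx; have [y ys yx] := sP x Qx.
exists (xget y [set x | Q x /\ eqm H y x]); first by apply/mapP; exists y.
have [|Qg yg] := @xgetPex _ y [set x | Q x /\ eqm H y x]; first by exists x.
by apply: QHK => //; apply: eqm_trans yx => //; apply: eqm_sym.
Qed.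

Lemma fincovI H K Q : subgroup H -> subgroup K ->
  fincov H Q -> fincov K Q -> fincov (H `&` K) Q.
Proof.
move=> sH sK [s sP] [t tP].
exists [seq xget x [set z | Q z /\ (eqm H x z /\ eqm K y z)] | x <- s, y <- t].
move=> z Qz; have [x xs xz] := sP z Qz; have [y yt yz] := tP z Qz.
have [|_ [xg yg]] := @xgetPex _ x [set z | Q z /\ (eqm H x z /\ eqm K y z)].
  by exists z.
exists (xget x [set z | Q z /\ (eqm H x z /\ eqm K y z)]).
  by apply/allpairsP; exists (x, y).
by split; [apply: eqm_trans xz|apply: eqm_trans yz] => //; apply: eqm_sym.
Qed.

End CosetRelation.

(** * Iterates of an automorphism and of its inverse *)

Section Automorphism.
Context {G : groupType}.
Variables (T S : G -> G) (TM : {morph T : x y / x * y}).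
Hypotheses (TK : cancel T S) (SK : cancel S T).
Implicit Types (H Q M : set G) (x y z : G).

Lemma autMV : {morph S : x y / x * y}.
Proof. by move=> x y; apply: (can_inj TK); rewrite TM !SK. Qed.

Lemma iter_autM n : {morph iter n T : x y / x * y}.
Proof. by move=> x y; elim: n => //= n ->. Qed.

Lemma iter_aut1 n : iter n T 1 = 1.
Proof. by apply: (@mulgI _ (iter n T 1)); rewrite -iter_autM !mulg1. Qed.

Lemma iter_autV n x : iter n T x^-1 = (iter n T x)^-1.
Proof. by apply: (@mulgI _ (iter n T x)); rewrite -iter_autM !mulgV iter_aut1. Qed.

Lemma aut1 : T 1 = 1.
Proof. exact: (iter_aut1 1). Qed.

Lemma autV x : T x^-1 = (T x)^-1.
Proof. exact: (iter_autV 1). Qed.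

Lemma iter_cancel n : cancel (iter n T) (iter n S).
Proof. by elim: n => // n ih x; rewrite iterSr /= TK ih. Qed.

Lemma iter_sub m n x : (n <= m)%N -> iter m S (iter n T x) = iter (m - n) S x.
Proof. by move=> nm; rewrite -{1}(subnK nm) iterD iter_cancel. Qed.

End Automorphism.

(** * Points that stay in [H] or eventually enter it *)

Section Attractors.
Context {G : groupType}.
Implicit Types (T S : G -> G) (H Q M : set G) (x y z : G).

(** With [S] the inverse of [T], [stays S H] is the intersection of the forward images of [H] under
    [T] (H_+ in scale theory), [stays T H] is its counterpart H_-, and [enters S H] is the
    increasing union of the forward images of [stays S H]. *)
Definition stays S H : set G := [set x | forall n, H (iter n S x)].

Definition enters S H : set G :=
  [set x | exists N, forall n, (N <= n)%N -> H (iter n S x)].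

Variables (T S : G -> G) (TM : {morph T : x y / x * y}).
Hypotheses (TK : cancel T S) (SK : cancel S T).
Variable H : set G.
Hypothesis sH : subgroup H.

Lemma subgroup_stays : subgroup (stays T H).
Proof.
apply: subgroupP => [n|x y Hx Hy n|x Hx n].
- by rewrite iter_aut1 //; apply: sub1g.
- by rewrite iter_autM //; apply: subMg.
- by rewrite iter_autV //; apply: subVg.
Qed.

Lemma subgroup_enters : subgroup (enters T H).
Proof.
apply: subgroupP => [|x y [n1 Hx] [n2 Hy]|x [n Hx]].
- by exists 0%N => n _; rewrite iter_aut1 //; apply: sub1g.
- exists (maxn n1 n2) => n; rewrite geq_max => /andP[n1n n2n].
  by rewrite iter_autM //; apply: subMg; [exact: sH|exact: Hx|exact: Hy].
- by exists n => m nm; rewrite iter_autV //; apply: subVg => //; apply: Hx.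
Qed.

Lemma stays_sub : stays T H `<=` H.
Proof. by move=> x /(_ 0%N). Qed.

Lemma stays_enters : stays T H `<=` enters T H.
Proof. by move=> x Hx; exists 0%N => n _; apply: Hx. Qed.

Lemma stays_iter m x : stays T H x -> stays T H (iter m T x).
Proof. by move=> Hx n; rewrite -iterD; apply: Hx. Qed.

Lemma enters_iter m x : enters T H x -> enters T H (iter m T x).
Proof.
move=> [N Hx]; exists N => n Nn; rewrite -iterD.
by apply: Hx; apply: leq_trans Nn (leq_addr _ _).
Qed.

Lemma enters_iterV m x : enters T H x -> enters T H (iter m S x).
Proof.
move=> [N Hx]; exists (N + m)%N => n Nn.
rewrite (iter_sub SK); last by apply: leq_trans Nn; rewrite leq_addl.
by apply: Hx; rewrite leq_subRL ?(addnC m) //; apply: leq_trans Nn; rewrite leq_addl.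
Qed.

End Attractors.

(** * Homoclinic points and the invariant compact open subgroup *)

Section OneSided.
Context {G : groupType}.
Implicit Types (T S : G -> G) (H Q M : set G) (x y z : G).

Definition torbit T S z : set G :=
  [set y | exists n, y = iter n T z \/ y = iter n S z].

(** The Markov property on points: a past and a future that meet in one coset of [H] are realised
    together by a single point. *)
Definition splicing T S H : Prop :=
  forall x y, eqm H x y -> exists w,
    (forall n, eqm H (iter n S x) (iter n S w)) /\
    (forall n, eqm H (iter n T y) (iter n T w)).

(** The form in which density is used. A point counts as bounded when its two-sided orbit meets
    finitely many cosets of [H]. *)
Definition approximable T S H : Prop :=
  forall n x, exists2 z, fincov H (torbit T S z) &
    forall i, (i <= n)%N -> eqm H (iter i T x) (iter i T z).

Definition homoclinic T S H : set G := enters S H `&` enters T H.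

Variables (T S : G -> G) (TM : {morph T : x y / x * y}).
Hypotheses (TK : cancel T S) (SK : cancel S T).
Variable H : set G.
Hypothesis sH : subgroup H.
Hypothesis commH : forall y, fincov H [set h * y | h in H].
Hypothesis spliceH : splicing T S H.
Hypothesis approxH : approximable T S H.

Let SM : {morph S : x y / x * y} := autMV TM TK SK.

Lemma subgroup_homoclinic : subgroup (homoclinic T S H).
Proof.
by apply: subgroupI; apply: subgroup_enters.
Qed.

(** [H Q] lies in finitely many double cosets [H y H], each finitely covered by [commH]. *)
Lemma fincov_mull Q : fincov H Q ->
  fincov H [set x | exists h q, [/\ H h, Q q & x = h * q]].
Proof.
move=> [s sP]; have [y _|s' s'P] := fincov_bigcup (s := s) (H := H)
  (Q := fun y => [set h * y | h in H]); first exact: commH.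
exists s' => _ [h [q [Hh Qq ->]]]; have [y ys yq] := sP _ Qq.
have [|z zs zy] := s'P (h * y); first by exists y => //; exists h.
by exists z => //; apply: eqm_trans zy _ => //; apply/eqm_mull.
Qed.

Lemma fincovV Q : fincov H Q -> fincov H [set x | Q x^-1].
Proof.
move=> [s sP]; have [|s' s'P] := @fincov_mull [set y | y^-1 \in s].
  exists ([seq y^-1 | y <- s]) => y ys; exists y; last exact: eqmxx.
  by apply/mapP; exists y^-1; rewrite ?invgK.
exists s' => x /sP[y ys yx]; apply: s'P.
exists (x * y), y^-1; split; rewrite ?mulgK //= ?invgK //.
by move/(subVg sH): yx; rewrite invgM !invgK.
Qed.

(** Splicing the past of [1] with the future of [x] yields the first factor. This is the
    factorisation of [H] as [stays S H] times [stays T H]. *)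
Lemma splice_dec x : H x -> exists2 a, stays S H a & stays T H (a^-1 * x).
Proof.
move=> Hx; have [|w [w1 w2]] := spliceH (x := 1) (y := x); first exact/eqm1.
exists w => n; first by have := w1 n; rewrite iter_aut1 // => /eqm1.
by have := eqm_sym sH (w2 n); rewrite /eqm -iter_autV // -iter_autM.
Qed.

(** If the orbit of [v] is in the same coset at times [j < k], the quotient [y] is in [H] and in
    [enters S H], so its factor [l] in [stays T H] is homoclinic. Pulling
    [iter k T v = iter j T v * h * l] back by [iter k S] decomposes [v]. *)
Lemma bounded_enters v : enters S H v -> fincov H [set iter n T v | n in setT] ->
  exists a, exists2 l, homoclinic T S H l & stays S H a /\ v = a * l.
Proof.
move=> Uv fv; have [N vN] := Uv.
(* Sampling at multiples of [N.+1] keeps distinct times at least [N] apart, which puts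
   [iter (k - j) S v] in [stays S H]. *)
have [|a [b [ab vab]]] := fincov_pigeonhole
  (g := fun n => iter (n * N.+1) T v) sH fv.
  by move=> n; exists (n * N.+1)%N.
set j := (a * N.+1)%N in vab; set k := (b * N.+1)%N in vab.
have jNk : (j + N <= k)%N.
  apply: leq_trans (leq_mul ab (leqnn N.+1)).
  by rewrite /j mulSn addnC leq_add2r leqnSn.
have jk : (j <= k)%N by apply: leq_trans jNk; rewrite leq_addr.
have sU := subgroup_enters SM sH; have sV := subgroup_enters TM sH.
have sP := subgroup_stays SM sH.
set y := (iter j T v)^-1 * iter k T v.
have Uy : enters S H y.
  by apply: subMg => //; [apply: subVg => //|]; apply: (enters_iterV TK).
have [h Ph Nh] := splice_dec vab; set l := h^-1 * y in Nh.
have Ll : homoclinic T S H l.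
  split; last exact: stays_enters.
  by apply: subMg => //; apply: subVg => //; apply: stays_enters.
exists (iter (k - j) S v * iter k S h), (iter k S l).
  by split; [apply: enters_iter; case: Ll|apply: (enters_iterV SK); case: Ll].
split.
  apply: (subMg sP); last exact: stays_iter.
  move=> n; rewrite -iterD; apply: vN.
  by apply: leq_trans (leq_addl _ _); rewrite leq_subRL.
rewrite -mulgA -(iter_autM SM) /l mulVKg -(iter_sub TK v jk).
rewrite -(iter_autM SM) /y mulVKg.
by rewrite (iter_cancel TK).
Qed.

(** A bounded [z] follows [iter N S u] for [N] steps. Replacing its past by that of [1] and moving
    [N] steps forward gives [b] in the coset of [u], in [enters S H], with bounded forward orbit. *)
Lemma enters_homoclinic u : enters S H u ->
  exists2 l, homoclinic T S H l & eqm H l u.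
Proof.
move=> [N uN]; have [z bz zu] := approxH N (iter N S u).
have Hz : H z.
  have /= := zu 0%N isT; apply: eqm_mem => //; exact: uN.
have [|w [w1 w2]] := spliceH (x := 1) (y := z); first exact/eqm1.
set b := iter N T w.
have bu : eqm H b u.
  apply: eqm_trans (eqm_sym sH (w2 N)) _ => //.
  by apply: eqm_sym => //; have := zu N (leqnn _); rewrite (iter_cancel SK).
have Ub : enters S H b.
  exists N => n Nn; rewrite (iter_sub TK) //.
  by have := w1 (n - N)%N; rewrite iter_aut1 // => /eqm1.
(* The decomposition is applied to [b^-1]: after inversion the factor from [stays S H] stands on the
   right and is absorbed by [H]. *)
have [||a [l Ll [Sa bal]]] := @bounded_enters b^-1.
- by apply: subVg => //; apply: subgroup_enters.
- have [s sP] := bz; have [|s' s'P] := @fincovV [set iter n T b | n in setT].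
    exists s => _ [n _ <-]; have [|y ys yz] := sP (iter (n + N) T z).
      by exists (n + N)%N; left.
    by exists y => //; rewrite /b -iterD; apply: eqm_trans yz (w2 _).
  exists s' => _ [n _ <-]; apply: s'P; exists n => //.
  by rewrite iter_autV // invgK.
exists l^-1; first by apply: subVg => //; apply: subgroup_homoclinic.
apply: eqm_trans bu => //; rewrite -[b]invgK bal invgM.
by apply: eqm_mulr; apply: subVg => //; apply: (stays_sub Sa).
Qed.

End OneSided.

(** * The invariant subgroup [L H] *)

Section InvariantSubgroup.
Context {G : groupType}.
Variables (T S : G -> G) (TM : {morph T : x y / x * y}).
Hypotheses (TK : cancel T S) (SK : cancel S T).
Variable H : set G.
Hypothesis sH : subgroup H.
Hypothesis commH : forall y, fincov H [set h * y | h in H].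
Hypothesis fincovT : fincov H [set T h | h in H].
Hypothesis spliceH : splicing T S H.
Hypothesis approxH : approximable T S H.

Let SM : {morph S : x y / x * y} := autMV TM TK SK.
Let L := homoclinic T S H.
Let sL : subgroup L := subgroup_homoclinic TM TK SK sH.

Lemma splicingC : splicing S T H.
Proof.
move=> x y xy; have [w [w1 w2]] := spliceH (eqm_sym sH xy).
by exists w.
Qed.

(** A point following [iter n S x] for [n] forward steps, once moved forward by [iter n T], follows
    [x] backward. *)
Lemma approximableC : approximable S T H.
Proof.
move=> n x; have [z fz xz] := approxH n (iter n S x).
exists (iter n T z); last first.
  move=> i ni; have := xz _ (leq_subr i n).
  by rewrite -{2 4}(subnK ni) iterD (iter_cancel SK) addnC iterD (iter_cancel TK).
apply: fincovS fz => _ [m [->|->]]; last first.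
  by exists (m + n)%N; left; rewrite iterD.
have [mn|/ltnW nm] := leqP m n.
  by exists (n - m)%N; left; rewrite -{1}(subnK mn) addnC iterD (iter_cancel TK).
by exists (m - n)%N; right; rewrite (iter_sub TK).
Qed.

Lemma homoclinicC : homoclinic S T H = L.
Proof. by rewrite /L /homoclinic setIC. Qed.

Lemma enters_homoclinicC v : enters T H v -> exists2 l, L l & eqm H l v.
Proof.
move=> /(enters_homoclinic SM SK TK sH commH splicingC approximableC).
by rewrite homoclinicC.
Qed.

Lemma fincov_iter n : fincov H [set iter n T h | h in H].
Proof.
elim: n => [|n [s sP]].
  by exists [:: 1] => _ [h Hh <-]; exists 1; rewrite ?inE //; apply/eqm1.
have [s' s'P] := fincovT.
exists [seq T y * z | y <- s, z <- s'] => _ [h Hh <-] /=.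
have [|y ys /eqmP[k Hk ->]] := sP (iter n T h); first by exists h.
have [|z zs zk] := s'P (T k); first by exists k.
exists (T y * z); last by rewrite TM eqm_mull.
by apply/allpairsP; exists (y, z).
Qed.

(* The finitely many cosets of [stays S H] in [T (stays S H)] that contain a
   homoclinic point are uniformly absorbed by [H] under forward iteration. *)
Lemma homoclinic_bound : exists M0, forall x, L x ->
  exists2 h, H h & stays S H (iter M0 S (h^-1 * x)).
Proof.
have sP := subgroup_stays SM sH.
pose Q := [set x | L x /\ stays S H (S x)].
have fQ : fincov (stays S H) Q.
  (* On [Q], equivalence modulo [H] implies equivalence modulo [stays S H], since [S] already sends
     quotients into [stays S H]. Moreover [Q] lies in the image of [H] under [T]. *)
  apply: (fincov_refine sH); last first.
    apply: fincovS fincovT => x [_ /stays_sub HSx].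
    by exists (S x); rewrite ?SK.
  move=> x y [_ Hx] [_ Hy] xy [|n] //; rewrite iterSr SM (autV SM).
  by apply: (subMg sP); [apply: (subVg sP)|].
pose P n x := exists c, [/\ L c, eqm (stays S H) c x &
  forall j, (n <= j)%N -> H (iter j T c)].
have [|||M0 M0P] := fincov_bound (P := P) sP fQ.
- move=> m n x mn [c [Lc cx Hc]]; exists c; split=> // j nj.
  by apply: Hc; apply: leq_trans nj.
- move=> m x y [c [Lc cx Hc]] xy; exists c; split=> //.
  exact: (eqm_trans sP cx xy).
- move=> x [Lx _]; have [_ [N Nx]] := Lx; exists N, x; split=> //; exact: (eqmxx x sP).
exists M0 => x Lx; have [[N Nx] _] := Lx.
have : stays S H (iter (M0 + N) S x).
  by move=> n; rewrite -iterD; apply: Nx; rewrite addnA leq_addl.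
elim: N x Lx {Nx} => [|N ih] x Lx.
  by rewrite addn0 => Hx; exists 1; [exact: sub1g|rewrite invg1 mul1g].
rewrite addnS iterS => Hx.
have Lx1 : L (iter (M0 + N) S x).
  by case: Lx => Ux Vx; split; [apply: enters_iter|apply: (enters_iterV SK)].
(* Dividing [x] on the left by [iter (M0 + N) T c], which is in [H] by the choice of [M0], makes the
   entry into [stays S H] happen one step earlier. *)
have [|c [Lc cx Hc]] := M0P (iter (M0 + N) S x); first by split.
have LTc : L (iter (M0 + N) T c).
  by case: Lc => Uc Vc; split; [apply: (enters_iterV TK)|apply: enters_iter].
have [||h Hh hP] := ih ((iter (M0 + N) T c)^-1 * x).
- by apply: (subMg sL) => //; apply: (subVg sL).
- by rewrite (iter_autM SM) (iter_autV SM) (iter_cancel TK).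
exists (iter (M0 + N) T c * h); last by rewrite invgM -mulgA.
by apply: subMg => //; apply: Hc; rewrite leq_addr.
Qed.

(** By the uniform bound, [L] lies in the product of [H] and its image under [iter M0 T]. *)
Lemma fincov_homoclinic : fincov H L.
Proof.
have [M0 M0P] := homoclinic_bound.
apply: fincovS (fincov_mull sH commH (fincov_iter M0)) => x /M0P[h Hh Hx].
exists h, (h^-1 * x); split => //; last by rewrite mulVKg.
exists (iter M0 S (h^-1 * x)); first exact: (stays_sub Hx).
by rewrite (iter_cancel SK).
Qed.

Definition homoclinic_hull : set G := [set x | exists2 l, L l & eqm H l x].
Let M := homoclinic_hull.

Lemma hullW x y : M x -> eqm H x y -> M y.
Proof. by move=> [l Ll lx] xy; exists l => //; apply: eqm_trans xy. Qed.

Lemma enters_hull : enters S H `<=` M.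
Proof. by move=> u /(enters_homoclinic TM TK SK sH commH spliceH approxH). Qed.

Lemma enters_hullC : enters T H `<=` M.
Proof. by move=> u /enters_homoclinicC. Qed.

Lemma sub_hull : H `<=` M.
Proof. by move=> h Hh; exists 1; [exact: sub1g|apply/eqm1]. Qed.

(** Permutability of [H] and [L], which makes [L H] a subgroup. Write [h = b^-1 * a^-1] with [a] in
    [stays S H] and [b] in [stays T H]: then [a^-1 * l] is in [enters S H], hence in the coset of
    some homoclinic [l'], and [b^-1 * l'] is in [enters T H]. *)
Lemma hull_HL h l : H h -> L l -> M (h * l).
Proof.
move=> Hh Ll; have [a Pa Na] := splice_dec TM TK SK sH spliceH (subVg sH Hh).
have [|l' [Ul' Vl'] l'P] := @enters_hull (a^-1 * l).
  apply: (subMg (subgroup_enters SM sH)); last by case: Ll.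
  apply: (subVg (subgroup_enters SM sH)); exact: stays_enters.
have Vb : enters T H ((a^-1 * h^-1)^-1 * l').
  apply: (subMg (subgroup_enters TM sH)) => //.
  by apply: (subVg (subgroup_enters TM sH)); exact: stays_enters.
apply: hullW (enters_hullC Vb) _.
have -> : h * l = (a^-1 * h^-1)^-1 * (a^-1 * l).
  by rewrite invgM !invgK !mulgA mulgK.
exact/eqm_mull.
Qed.

Lemma subgroup_hull : subgroup M.
Proof.
apply: subgroupP => [|x y [l Ll /eqmP[h Hh ->]] [l' Ll' /eqmP[h' Hh' ->]]|].
- by apply: sub_hull; apply: sub1g.
- have [l'' Ll'' l''P] := hull_HL Hh Ll'.
  exists (l * l''); first exact: (subMg sL).
  rewrite -mulgA eqm_mull mulgA; apply: eqm_trans l''P _ => //.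
  exact: eqm_mulr.
- move=> x [l Ll /eqmP[h Hh ->]]; rewrite invgM.
  by apply: hull_HL; [exact: subVg|exact: (subVg sL)].
Qed.

(** Of the two factors of [h], [T] keeps the one from [stays T H] inside [H] and sends the other
    into [enters S H], which lies in the hull. *)
Lemma hull_T x : M x -> M (T x).
Proof.
have sM := subgroup_hull.
move=> [l [Ul Vl] /eqmP[h Hh ->]]; rewrite TM.
apply: (subMg sM).
  by apply: enters_hullC; apply: (enters_iter 1).
have [a Pa Na] := splice_dec TM TK SK sH spliceH Hh.
rewrite -(mulVKg a h) TM; apply: (subMg sM).
  by apply: enters_hull; apply: (enters_iterV TK 1); apply: stays_enters.
by apply: sub_hull; apply: (Na 1%N).
Qed.

Lemma hull_S x : M x -> M (S x).
Proof.
have sM := subgroup_hull.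
move=> [l [Ul Vl] /eqmP[h Hh ->]]; rewrite SM.
apply: (subMg sM).
  by apply: enters_hull; apply: (enters_iter 1).
have [a Pa Na] := splice_dec TM TK SK sH spliceH Hh.
rewrite -(mulVKg a h) SM; apply: (subMg sM).
  by apply: sub_hull; apply: (Pa 1%N).
by apply: enters_hullC; apply: (enters_iterV SK 1); apply: stays_enters.
Qed.

Lemma fincov_hull : fincov H M.
Proof.
have [s sP] := fincov_homoclinic; exists s => x [l Ll lx].
by have [y ys yl] := sP l Ll; exists y => //; apply: eqm_trans lx.
Qed.

Lemma invariant_subgroup : exists M, [/\ subgroup M, H `<=` M, fincov H M,
  (forall x, M x <-> M (T x)) &
  forall x, M x -> exists2 u, enters S H u & eqm H u x].
Proof.
exists M; split.
- exact: subgroup_hull.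
- exact: sub_hull.
- exact: fincov_hull.
- by move=> x; split=> [/hull_T //|/hull_S]; rewrite TK.
- by move=> x [l [Ul _] lx]; exists l.
Qed.

End InvariantSubgroup.

(** * A chain of normal subgroups *)

Section NormalChain.
Context {G : groupType}.
Implicit Types (N K Q : set G) (x y z : G).

Definition mulset N K : set G :=
  [set x | exists n k, [/\ N n, K k & x = n * k]].

Variable M : set G.
Hypothesis sM : subgroup M.

Definition normal_in N : Prop := [/\ subgroup N, N `<=` M &
  forall m n, M m -> N n -> N (m^-1 * n * m)].

Lemma normal_inJ N m n : normal_in N -> M m -> N n -> N (m * n * m^-1).
Proof.
by move=> [_ _ nN] Mm Nn; rewrite -{1}[m]invgK; apply: nN => //; apply: subVg.
Qed.

Lemma subgroup_mulset N K : normal_in N -> subgroup K -> K `<=` M ->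
  subgroup (mulset N K).
Proof.
move=> nN sK KM; have [sN NM nNM] := nN.
apply: subgroupP.
- by exists 1, 1; split; rewrite ?mulg1 //; apply: sub1g.
- move=> _ _ [n [k [Nn Kk ->]]] [n' [k' [Nn' Kk' ->]]].
  exists (n * (k * n' * k^-1)), (k * k'); split.
  + by apply: subMg => //; apply: normal_inJ => //; apply: KM.
  + exact: subMg.
  + by rewrite !mulgA mulgVK.
- move=> _ [n [k [Nn Kk ->]]]; exists (k^-1 * n^-1 * k), k^-1; split.
  + by apply: nNM; [apply: KM|apply: subVg].
  + exact: subVg.
  + by rewrite invgM mulgK.
Qed.

Lemma normal_in_mulset N K : normal_in N -> normal_in K ->
  normal_in (mulset N K).
Proof.
move=> nN nK; have [sN NM nNM] := nN; have [sK KM nKM] := nK; split.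
- exact: subgroup_mulset.
- by move=> _ [n [k [Nn Kk ->]]]; apply: subMg => //; [apply: NM|apply: KM].
- move=> m _ Mm [n [k [Nn Kk ->]]].
  exists (m^-1 * n * m), (m^-1 * k * m); split; [exact: nNM|exact: nKM|].
  by rewrite !mulgA mulgK.
Qed.

Lemma normal_in_preim (T : G -> G) N : {morph T : x y / x * y} ->
  (forall x, M x <-> M (T x)) -> normal_in N -> normal_in [set x | N (T x)].
Proof.
move=> TM MT [sN NM nNM]; split.
- apply: subgroupP => /= [|x y Nx Ny|x Nx]; rewrite ?aut1 ?TM ?(autV TM) //;
    by [apply: sub1g|apply: subMg|apply: subVg].
- by move=> x /NM /(MT x).2.
- by move=> m n Mm Nn /=; rewrite !TM (autV TM); apply: nNM => //; apply/(MT m).1.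
Qed.

Variable H : set G.
Hypotheses (sH : subgroup H) (HM : H `<=` M) (fHM : fincov H M).

(** The kernel of the action of [M] on [M/H], that is, the normal core of [H] in [M]. *)
Definition coset_fixer : set G := [set g | M g /\ forall x, M x -> H (x^-1 * g * x)].

Lemma fixer_sub : coset_fixer `<=` H.
Proof. by move=> g [_ /(_ 1 (sub1g sM))]; rewrite invg1 mul1g mulg1. Qed.

Lemma normal_fixer : normal_in coset_fixer.
Proof.
split; first apply: subgroupP.
- split; first exact: sub1g.
  by move=> x _; rewrite mulg1 mulVg; apply: sub1g.
- move=> x y [Mx Hx] [My Hy]; split; first exact: subMg.
  move=> z Mz; have -> : z^-1 * (x * y) * z = (z^-1 * x * z) * (z^-1 * y * z).
    by rewrite !mulgA mulgK.
  by apply: subMg => //; [apply: Hx|apply: Hy].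
- move=> x [Mx Hx]; split; first exact: subVg.
  move=> z Mz; have -> : z^-1 * x^-1 * z = (z^-1 * x * z)^-1.
    by rewrite !invgM invgK mulgA.
  by apply: subVg => //; apply: Hx.
- by move=> x [].
- move=> m n Mm [Mn Hn]; split; first by do 2?apply: subMg => //; apply: subVg.
  move=> z Mz; have -> : z^-1 * (m^-1 * n * m) * z = (m * z)^-1 * n * (m * z).
    by rewrite invgM !mulgA.
  by apply: Hn; apply: subMg.
Qed.

(** The core is the intersection of the conjugates of [H] by representatives of [M/H]: finitely many
    subgroups, each of finite index in [M]. *)
Lemma fincov_fixer : fincov coset_fixer M.
Proof.
have fconj (s : seq G) : (forall y, y \in s -> M y) ->
    subgroup [set g | forall y, y \in s -> H (y^-1 * g * y)] /\
    fincov [set g | forall y, y \in s -> H (y^-1 * g * y)] M.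
  have sconj (t : seq G) : subgroup [set g | forall y, y \in t -> H (y^-1 * g * y)].
    apply: subgroupP => [y _|g g' Hg Hg' y yt|g Hg y yt].
    - by rewrite mulg1 mulVg; apply: sub1g.
    - have -> : y^-1 * (g * g') * y = (y^-1 * g * y) * (y^-1 * g' * y).
        by rewrite !mulgA mulgK.
      by apply: subMg; [exact: sH|exact: Hg|exact: Hg'].
    - have -> : y^-1 * g^-1 * y = (y^-1 * g * y)^-1.
        by rewrite !invgM invgK mulgA.
      by apply: subVg => //; apply: Hg.
  elim: s => [|y s ih] Ms; (split; first exact: sconj).
    by exists [:: 1] => x _; exists 1; rewrite ?inE.
  have [|_ fs] := ih; first by move=> z zs; apply: Ms; rewrite inE zs orbT.
  have sy := sconj [:: y].
  have fy : fincov [set g | forall z, z \in [:: y] -> H (z^-1 * g * z)] M.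
    have [t tP] := fHM; exists [seq z * y^-1 | z <- t] => x Mx.
    have My : M y by apply: Ms; rewrite mem_head.
    have [z zt zx] := tP (x * y) (subMg sM Mx My).
    exists (z * y^-1); first by apply/mapP; exists z.
    move=> w; rewrite inE => /eqP->; move: zx; rewrite /eqm invgM invgK.
    by rewrite !mulgA mulVg mul1g.
  apply: fincov_refine (fincovI sy (sconj s) fy fs); last first.
    move=> u v _ _ [uvy uvs] z; rewrite inE => /orP[/eqP->|]; last exact: uvs.
    by apply: uvy; rewrite mem_head.
  exact: subgroupI.
have [s' [s'M s'P]] : exists s : seq G, (forall y, y \in s -> M y) /\
    forall x, M x -> exists2 y, y \in s & eqm H y x.
  have [s sP] := fHM; exists [seq y <- s | `[< M y >]]; split.
    by move=> y; rewrite mem_filter => /andP[/asboolP].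
  move=> x Mx; have [y ys yx] := sP x Mx; exists y => //.
  rewrite mem_filter ys andbT; apply/asboolP.
  by apply: eqm_mem (eqm_sym sH yx).
have [ss fs] := fconj s' s'M.
apply: fincov_refine fs => // u v Mu Mv uv; split.
  by apply: subMg => //; apply: subVg.
move=> x /s'P[y ys /eqmP[h Hh ->]].
rewrite invgM -!mulgA; apply: subMg => //; first exact: subVg.
by rewrite !mulgA; apply: subMg => //; have := uv y ys; rewrite !mulgA.
Qed.

End NormalChain.

(** * The chain attached to [T] and its adapted section *)

Section Chain.
Context {G : groupType}.
Variables (T S : G -> G) (TM : {morph T : x y / x * y}).
Hypotheses (TK : cancel T S) (SK : cancel S T).
Variables H M : set G.
Hypotheses (sH : subgroup H) (sM : subgroup M) (HM : H `<=` M).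
Hypotheses (fHM : fincov H M) (MT : forall x, M x <-> M (T x)).

Let SM : {morph S : x y / x * y} := autMV TM TK SK.
Let C := coset_fixer M H.
Let nC : normal_in M C := normal_fixer sM sH.

Fixpoint chain i : set G :=
  if i is i'.+1 then [set x | mulset (chain i') C (T x)] else [set 1].

Let R i := mulset (chain i) C.

Lemma normal_chain i : normal_in M (chain i).
Proof.
elim: i => [|i ih] /=; last first.
  exact: normal_in_preim (normal_in_mulset sM ih nC).
split.
- apply: subgroupP => // [x y -> ->|x ->]; first by rewrite mulg1.
  by rewrite invg1.
- by move=> _ ->; apply: sub1g.
- by move=> m _ _ ->; rewrite /= mulg1 mulVg.
Qed.

Lemma sub_chainS i : chain i `<=` chain i.+1.
Proof.
have C1 : C 1 by case: nC => sC _ _; apply: sub1g.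
elim: i => [_ ->|i ih x [q [c [Qq Cc qc]]]].
  by exists 1, 1; split; rewrite // mulg1 (aut1 TM).
by exists q, c; split => //; apply: ih.
Qed.

Lemma sub_chain i j : (i <= j)%N -> chain i `<=` chain j.
Proof.
move=> /subnK <-; elim: (j - i)%N => // n ih x Qx.
by apply: sub_chainS; apply: ih.
Qed.

Definition thick i : set G := mulset (chain i) H.

Lemma subgroup_thick i : subgroup (thick i).
Proof. by apply: (subgroup_mulset sM) => //; apply: normal_chain. Qed.

Lemma sub_thick i : H `<=` thick i.
Proof.
move=> h Hh; exists 1, h; rewrite mul1g; split=> //.
by have [sQ _ _] := normal_chain i; apply: sub1g.
Qed.

Lemma thick_mono i j : (i <= j)%N -> thick i `<=` thick j.
Proof.
move=> ij _ [q [h [Qq Hh ->]]]; exists q, h; split=> //; exact: sub_chain Qq.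
Qed.

Lemma thick0 : thick 0 = H.
Proof.
apply/seteqP; split; last exact: sub_thick.
by move=> _ [_ [h [-> Hh ->]]]; rewrite mul1g.
Qed.

Lemma thick_sub i : thick i `<=` M.
Proof.
move=> _ [q [h [Qq Hh ->]]]; have [_ QM _] := normal_chain i.
by apply: subMg => //; [apply: QM|apply: HM].
Qed.

Let R_S i x : R i x -> R i.+1 (S x).
Proof.
move=> Rx; exists (S x), 1; split; rewrite ?mulg1 //= ?SK //.
by case: nC => sC _ _; apply: sub1g.
Qed.

(** A return modulo the finite-index [C] at times [a < b] puts [(iter q S u)^-1 * u] in [R (q + a)],
    where [q = b - a]. Telescoping such steps goes back far enough for the remaining factor [h] to
    lie in [H], and normality moves [h] past the chain. *)
Lemma enters_thick u : M u -> enters S H u -> exists i, thick i u.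
Proof.
move=> Mu [N uN].
have sC : subgroup C by case: nC.
have sR i : subgroup (R i).
  apply: (subgroup_mulset sM) => //; first exact: normal_chain.
  by case: nC.
have R_mono i j x : (i <= j)%N -> R i x -> R j x.
  move=> ij [q [c [Qq Cc ->]]]; exists q, c; split=> //; exact: sub_chain Qq.
have R_iterS n i x : R i x -> R (n + i)%N (iter n S x).
  by move=> Rx; elim: n => // n ih; apply: R_S.
have MTn n : M (iter n T u) by elim: n => // n; rewrite iterS -MT.
have [a [b [ab uab]]] := fincov_pigeonhole sC (fincov_fixer sM sH HM fHM) MTn.
pose q := (b - a)%N; have q0 : (0 < q)%N by rewrite subn_gt0.
have ba : b = (a + q)%N by rewrite subnKC // ltnW.
have R0 : R (q + a)%N ((iter q S u)^-1 * u).
  have -> : (iter q S u)^-1 * u =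
      iter (q + a) S ((iter a T u)^-1 * iter b T u).
    rewrite (iter_autM SM) (iter_autV SM) iterD (iter_cancel TK) ba.
    by rewrite (addnC q) (iter_cancel TK).
  rewrite -[X in R X]addn0; apply: R_iterS.
  exists 1, ((iter a T u)^-1 * iter b T u); rewrite mul1g.
  by split=> //; case: (normal_chain 0) => s0 _ _; apply: sub1g.
have Rk k : exists i, R i ((iter (k * q) S u)^-1 * u).
  elim: k => [|k [i Ri]].
    by exists 0%N; rewrite mul0n mulVg; apply: sub1g.
  exists (maxn (k * q + (q + a)) i).
  have -> : (iter (k.+1 * q) S u)^-1 * u =
      iter (k * q) S ((iter q S u)^-1 * u) * ((iter (k * q) S u)^-1 * u).
    by rewrite (iter_autM SM) (iter_autV SM) -iterD mulSn addnC mulgA mulgK.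
  apply: subMg => //; last by apply: R_mono Ri; rewrite leq_maxr.
  by apply: (R_mono (k * q + (q + a))%N); rewrite ?leq_maxl //; apply: R_iterS.
(* Since [q] is positive, [N] periods go back at least [N] steps. *)
have [i [p [c [Qp Cc pc]]]] := Rk N; exists i.
set h := iter (N * q) S u in pc.
have Hh : H h by apply: uN; rewrite leq_pmulr.
exists (h * p * h^-1), (h * c); split.
- by apply: (normal_inJ sM) => //; [exact: normal_chain|exact: HM].
- by apply: subMg => //; apply: fixer_sub Cc.
- by rewrite !mulgA mulgVK -mulgA -pc mulVKg.
Qed.

Hypothesis enterM : forall x, M x -> exists2 u, enters S H u & eqm H u x.

(** Every coset of [H] in [M] meets [enters S H], hence lies in some [thick i]; there are finitely
    many cosets, so one index suffices. *)
Lemma thick_top : exists r, thick r = M.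
Proof.
have [|||r rP] := fincov_bound (P := thick) sH fHM.
- by move=> m n x mn; apply: thick_mono.
- move=> m x y mx /sub_thick-/(_ m) xy.
  by apply: eqm_mem xy => //; apply: subgroup_thick.
- move=> x Mx; have [u Uu ux] := enterM Mx.
  have [|i ui] := enters_thick _ Uu.
    by apply: eqm_mem (eqm_sym sH ux).
  exists i; apply: eqm_mem ux => //; [exact: subgroup_thick|exact: sub_thick].
- by exists r; apply/seteqP; split=> // x; apply: thick_sub.
Qed.

(* Normality in [M] lets [t] be moved past [chain i]. *)
Lemma thick_step i x y t : chain i.+1 (x^-1 * y) -> M t ->
  eqm (thick i) (T x * t) (T y * t).
Proof.
move=> [q [c [Qq Cc qc]]] Mt.
have -> : T y = T x * (q * c) by rewrite -qc -TM mulVKg.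
rewrite -mulgA eqm_mull /eqm.
have [_ _ nQ] := normal_chain i; have [_ _ nC'] := nC.
exists (t^-1 * q * t), (t^-1 * c * t); split; first exact: nQ.
  by apply: (fixer_sub sM); apply: nC'.
by rewrite !mulgA mulgK.
Qed.

(* The section is chosen on cosets of [thick r] first, then refined down to
   [thick 0], which is [H]. *)
Lemma coherent_section r : thick r = M -> exists sec : G -> G,
  [/\ forall x, eqm H x (sec x), forall x y, eqm H x y -> sec x = sec y &
   forall i x y, (i <= r)%N -> eqm (thick i) x y ->
     chain i ((sec x)^-1 * sec y)].
Proof.
move=> rM.
suff : forall d, (d <= r)%N -> exists sec : G -> G,
    [/\ forall x, eqm (thick (r - d)) x (sec x),
     forall x y, eqm (thick (r - d)) x y -> sec x = sec y &
     forall i x y, (r - d <= i <= r)%N -> eqm (thick i) x y ->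
       chain i ((sec x)^-1 * sec y)].
  move=> /(_ r (leqnn r)); rewrite subnn thick0 => -[sec [s1 s2 s3]].
  by exists sec; split=> // i x y ir; apply: s3.
have get_ext (P : G -> set G) i :
    (forall x y, eqm (thick i) x y -> P x `<=` P y) ->
    forall x y, eqm (thick i) x y -> xget 1 (P x) = xget 1 (P y).
  move=> Pxy x y xy; congr xget; apply/seteqP; split; first exact: Pxy.
  by apply: Pxy; apply: eqm_sym => //; apply: subgroup_thick.
have chain1 i x : chain i (x^-1 * x).
  by rewrite mulVg; have [sQ _ _] := normal_chain i; apply: sub1g.
elim=> [_|d ih dr].
  rewrite subn0; pose sec x := xget 1 [set y | eqm (thick r) x y].
  have secE : forall x y, eqm (thick r) x y -> sec x = sec y.
    apply: get_ext => x y xy z /=; apply: eqm_trans; first exact: subgroup_thick.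
    by apply: eqm_sym => //; apply: subgroup_thick.
  exists sec; split=> //.
    move=> x; apply: (@xgetPex _ 1 [set y | eqm (thick r) x y]).
    by exists x; apply: eqmxx; apply: subgroup_thick.
  move=> i x y /andP[ri ir]; have -> : i = r by apply/eqP; rewrite eqn_leq ri ir.
  by move=> /secE ->.
have [sec [s1 s2 s3]] := ih (ltnW dr).
set k := (r - d.+1)%N; have kE : (r - d)%N = k.+1 by rewrite /k subnSK.
rewrite kE in s1 s2 s3.
(* The new value lies in the finer coset of [x] and within [chain k.+1] of the old value, so
   coherence at the levels above [k] survives. *)
pose P x := [set y | eqm (thick k) x y /\ chain k.+1 ((sec x)^-1 * y)].
pose sec' x := xget 1 (P x).
have sec'E : forall x y, eqm (thick k) x y -> sec' x = sec' y.
  apply: get_ext => x y xy z [xz cz]; split.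
    apply: eqm_trans xz; first exact: subgroup_thick.
    by apply: eqm_sym => //; apply: subgroup_thick.
  by rewrite -(s2 x y) //; apply: thick_mono xy.
have sec'P x : P x (sec' x).
  apply: xgetPex; have [q [h [Qq Hh xqh]]] := s1 x.
  have [sQ QM nQ] := normal_chain k.+1.
  have Hh' : thick k h by apply: sub_thick.
  (* As [sec x = x * q * h], the point [x * h] differs from [sec x] by a conjugate of [q^-1], which
     is in the chain by normality. *)
  exists (x * h); split; first exact: eqm_mulr.
  have -> : (sec x)^-1 * (x * h) = h^-1 * q^-1 * h.
    by rewrite mulgA -[_ * x]invgK invgM invgK xqh invgM.
  by apply: nQ; [exact: HM|exact: subVg].
exists sec'; split=> // [x|i x y /andP[ki ir]]; first by case: (sec'P x).
move: ki; rewrite leq_eqVlt => /orP[/eqP <- /sec'E -> //|ki xy].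
have [_ cx] := sec'P x; have [_ cy] := sec'P y.
have [sQ _ _] := normal_chain i.
have cxy : chain i ((sec x)^-1 * sec y) by apply: s3; rewrite ?ki.
have -> : (sec' x)^-1 * sec' y =
    ((sec x)^-1 * sec' x)^-1 * ((sec x)^-1 * sec y) * ((sec y)^-1 * sec' y).
  by rewrite invgM invgK !mulgA !mulgK.
apply: (subMg sQ); last exact: (sub_chain ki).
by apply: (subMg sQ) => //; apply: (subVg sQ); apply: (sub_chain ki).
Qed.

End Chain.

(** * Synchronising labels *)

Section Letters.
Context {G : groupType}.

Lemma fincov_reps (H Q : set G) : subgroup H -> fincov H Q ->
  exists m (t : 'I_m -> G), [/\ forall a, Q (t a),
    forall x, Q x -> exists a, eqm H (t a) x &
    forall a b, eqm H (t a) (t b) -> a = b].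
Proof.
move=> sH [s sP].
pose g y := xget 1 [set z | Q z /\ eqm H y z].
(* [g] is constant on cosets, so removing duplicates leaves one representative per coset. *)
pose s' := undup [seq g y | y <- s & `[< exists z, Q z /\ eqm H y z >]].
have s'Q z : z \in s' -> exists2 y, z = g y & (Q z /\ eqm H y z).
  rewrite mem_undup => /mapP[y]; rewrite mem_filter => /andP[/asboolP ey ys] ->.
  by exists y => //; apply: (@xgetPex _ 1 [set z | Q z /\ eqm H y z]).
exists (size s'), (tnth (in_tuple s')); split.
- by move=> a; have [y _ []] := s'Q _ (mem_tnth a (in_tuple s')).
- move=> x Qx; have [y ys yx] := sP x Qx.
  have [|Qg yg] := @xgetPex _ 1 [set z | Q z /\ eqm H y z]; first by exists x.
  have gs : g y \in in_tuple s'.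
    rewrite /= mem_undup; apply/mapP; exists y => //.
    by rewrite mem_filter ys andbT; apply/asboolP; exists x.
  have /tnthP[a ga] := gs; exists a; rewrite -ga.
  by apply: eqm_trans (eqm_sym sH yg) yx.
- move=> a b; have [y ya [_ yga]] := s'Q _ (mem_tnth a (in_tuple s')).
  have [z zb [_ zgb]] := s'Q _ (mem_tnth b (in_tuple s')) => ab.
  have : tnth (in_tuple s') a = tnth (in_tuple s') b.
    have yz : eqm H y z.
      apply: eqm_trans (eqm_sym sH zgb) => //; exact: eqm_trans yga ab.
    rewrite ya zb /g; congr xget; apply/seteqP.
    by split=> w [Qw ww]; split=> //; apply: eqm_trans ww => //; apply: eqm_sym.
  rewrite !(tnth_nth 1) /= => /eqP; rewrite nth_uniq ?undup_uniq //.
  by move/eqP/val_inj.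
Qed.

Variables (T S : G -> G) (TM : {morph T : x y / x * y}).
Hypotheses (TK : cancel T S) (SK : cancel S T).
Variables H M : set G.
Hypotheses (sH : subgroup H) (sM : subgroup M) (HM : H `<=` M).
Hypothesis MT : forall x, M x <-> M (T x).
Variables (m : nat) (t : 'I_m -> G) (a0 : 'I_m).
Hypothesis tH : forall a, [set T h | h in H] (t a).
Hypothesis t_ex : forall x, [set T h | h in H] x -> exists a, eqm H (t a) x.
Hypothesis t_inj : forall a b, eqm H (t a) (t b) -> a = b.
Variables (r : nat) (sec : G -> G).
Hypothesis thickM : thick T H M r = M.
Hypothesis secP : forall x, eqm H x (sec x).
Hypothesis secE : forall x y, eqm H x y -> sec x = sec y.
Hypothesis secC : forall i x y, (i <= r)%N -> eqm (thick T H M i) x y ->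
  chain T H M i ((sec x)^-1 * sec y).

Definition edge x y : Prop := exists2 z, eqm H x z & eqm H (T z) y.

(** [T] maps the coset of [x] onto [T (sec x)] times the image of [H], so the [t a] label the
    successors of every coset by one alphabet. *)
Definition follow x a : G := T (sec x) * t a.

(** The default [a0] is returned only when no edge leads from [x] to [y]; otherwise the label is
    unique. *)
Definition letter x y : 'I_m := xget a0 [set a | eqm H (follow x a) y].

Lemma follow_inj x a b : eqm H (follow x a) (follow x b) -> a = b.
Proof. by move/eqm_mull/t_inj. Qed.

Lemma letterP x y : edge x y -> eqm H (follow x (letter x y)) y.
Proof.
move=> [z xz zy]; apply: (@xgetPex _ a0 [set a | eqm H (follow x a) y]).
have [h Hh zsec] : exists2 h, H h & z = sec x * h.
  apply: eqmP; apply: eqm_trans xz => //; exact: eqm_sym.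
have [|a ta] := t_ex (x := T h); first by exists h.
exists a; apply: eqm_trans zy => //.
by rewrite zsec TM; apply/eqm_mull.
Qed.

Lemma letter_follow x y a : eqm H (follow x a) y -> letter x y = a.
Proof.
move=> xay; apply: (@xget_unique _ a0 [set b | eqm H (follow x b) y]) => // b xby.
apply: (@follow_inj x); apply: eqm_trans xby (eqm_sym sH xay) => //.
Qed.

Lemma edge_follow x a : edge x (follow x a).
Proof.
have [h Hh hta] := tH a.
exists (sec x * h); last by rewrite TM hta; apply: eqmxx.
by apply: eqm_trans (secP x) _ => //; apply: eqm_mulr.
Qed.

Lemma letter_M a : M (t a).
Proof. by have [h /HM/MT Mh <-] := tH a. Qed.

Lemma follow_M x a : eqm M (T x) (follow x a).
Proof.
apply: (eqm_trans sM (y := T (sec x))); last exact: (eqm_mulr _ (letter_M a)).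
have /HM/MT := secP x.
by rewrite /eqm TM (autV TM).
Qed.

Fixpoint run x (w : nat -> 'I_m) n : G :=
  if n is n'.+1 then follow (run x w n') (w n') else x.

Lemma run_shift x w n :
  run x w n.+1 = run (follow x (w 0%N)) (fun i => w i.+1) n.
Proof. by elim: n => //= n ->. Qed.

Lemma run_M x w n : eqm M (iter n T x) (run x w n).
Proof.
elim: n => [|n ih] /=; first exact: eqmxx.
apply: eqm_trans (follow_M _ _) => //.
by move/MT: ih; rewrite TM (autV TM).
Qed.

(** Each common letter lowers the level of equivalence by one, from [thick r], which is [M], down to
    [thick 0], which is [H]. *)
Lemma run_sync x y w : eqm M x y -> eqm H (run x w r) (run y w r).
Proof.
move=> xy; suff: eqm (thick T H M (r - r)) (run x w r) (run y w r).
  by rewrite subnn thick0.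
suff run_n n : (n <= r)%N -> eqm (thick T H M (r - n)) (run x w n) (run y w n).
  exact: run_n.
elim: n => [_|n ih nr]; first by rewrite subn0 thickM.
have kE : (r - n)%N = (r - n.+1).+1 by rewrite subnSK.
rewrite /= /follow; apply: (thick_step TM sH sM MT); last exact: letter_M.
by apply: secC; rewrite -?kE ?leq_subr //; apply/ih/ltnW.
Qed.

End Letters.

(** * Topology and the conjugacy *)

Section Iterz.
Variables (X : choiceType) (f : X -> X) (bijf : bijective f).

Lemma pinv_idK : cancel f ('pinv_id [set: X] f).
Proof.
by move=> y; apply: pinvKV; rewrite ?inE // => ? ? _ _; apply: bij_inj.
Qed.

Lemma pinv_idKV : cancel ('pinv_id [set: X] f) f.
Proof. exact/(bij_can_sym bijf)/pinv_idK. Qed.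

Lemma iterzSr j x : iterz f (j + 1)%R x = f (iterz f j x).
Proof.
case: j => [n|[|n]]; rewrite /iterz.
- by rewrite (_ : (Posz n + 1)%R = Posz n.+1) // -PoszD addn1.
- by rewrite /= pinv_idKV.
- have -> : (Negz n.+1 + 1)%R = Negz n.
    by rewrite !NegzE -[n.+2]addn1 PoszD GRing.opprD GRing.addrNK.
  by rewrite [in RHS]iterS pinv_idKV.
Qed.

Lemma iterzD j n x : iterz f (j + n%:Z)%R x = iter n f (iterz f j x).
Proof.
elim: n => [|n ih]; first by rewrite GRing.addr0.
by rewrite -addn1 PoszD GRing.addrA iterzSr ih addn1.
Qed.

End Iterz.

(** * Coset covers from compactness *)

Section Topology.
Context {G : topologicalGroupType}.
Implicit Types (H Q : set G) (x y z : G).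

Lemma mull_continuous y : continuous (fun x : G => y * x).
Proof.
move=> x; apply: (@continuous_comp _ _ _ (fun x : G => (y, x))
  (fun xy : G * G => xy.1 * xy.2)); last exact: mulg_continuous.
by apply: cvg_pair; [exact: cvg_cst|exact: cvg_id].
Qed.

Lemma mulr_continuous y : continuous (fun x : G => x * y).
Proof.
move=> x; apply: (@continuous_comp _ _ _ (fun x : G => (x, y))
  (fun xy : G * G => xy.1 * xy.2)); last exact: mulg_continuous.
by apply: cvg_pair; [exact: cvg_id|exact: cvg_cst].
Qed.

Lemma open_eqm H y : open H -> open [set z | eqm H y z].
Proof. by move=> oH; apply: open_comp oH => + _; exact: mull_continuous. Qed.

(** Otherwise the sets missing only a finitely covered part of [Q] form a proper filter. At a
    cluster point [p], the coset of [p] would meet its own complement, which belongs to the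
    filter. *)
Lemma compact_fincov H Q : subgroup H -> open H -> compact Q -> fincov H Q.
Proof.
move=> sH oH cQ; apply: contrapT => nQ.
pose F : set_system G := [set B | fincov H (Q `\` B)].
have FF : ProperFilter F.
  split; first by rewrite /F /= setD0.
  split.
  - by exists [::] => x [_ /(_ I)].
  - move=> A B [s sP] [t tP]; exists (s ++ t) => x [Qx nAB].
    have [Ax|nAx] := pselect (A x).
      have [|y yt yx] := tP x; first by split=> // Bx; apply: nAB.
      by exists y => //; rewrite mem_cat yt orbT.
    have [|y ys yx] := sP x; first by [].
    by exists y => //; rewrite mem_cat ys.
  - by move=> A B AB; apply: fincovS => x [Qx nB]; split=> // /AB.
have FQ : F Q by exists [::] => x [Qx /(_ Qx)].
have [p [Qp clp]] := cQ F FF FQ.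
have [||x [nx px]] := clp (~` [set z | eqm H p z]) [set z | eqm H p z].
- by exists [:: p] => x [_ /contrapT px]; exists p => //; rewrite inE.
- by apply: open_nbhs_nbhs; split; [exact: open_eqm|exact: eqmxx].
- exact: nx.
Qed.

End Topology.

(** * Splicing and approximation from the hypotheses on [T] *)

Section Memoryless.
Context {G : topologicalGroupType}.
Variables (T : G -> G) (morphT : {morph T : x y / x * y}).
Hypotheses (bijT : bijective T) (contT : continuous T).
Variable H : set G.
Hypotheses (sH : subgroup H) (compactH : compact H) (openH : open H).
Hypothesis memH : memoryless T H.
Hypothesis denseT : dense [set x : G | compact (closure (orbitz T x))].

Let S := 'pinv_id [set: G] T.
Let TK : cancel T S := pinv_idK bijT.
Let SK : cancel S T := pinv_idKV bijT.

Lemma to_coset_eq x y : to_coset H x = to_coset H y <-> eqm H x y.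
Proof.
split=> [/(congr1 set_val)/= /(lcoset_eq _ _ sH) //|/(lcoset_eq _ _ sH) xy].
by apply: val_inj.
Qed.

Lemma allowed_edge x y : allowed T H (to_coset H x) (to_coset H y) <-> edge T H x y.
Proof.
split=> [[_ [[_ [h Hh <-] <-] [k Hk ykT]]]|[z /eqmP[h Hh ->] /eqmP[k Hk ->]]].
  exists (x * h); first exact: eqm_mulr.
  by rewrite -ykT; apply: eqm_sym => //; apply: eqm_mulr.
exists (T (x * h)); split; first by exists (x * h) => //; exists h.
by exists k^-1; [exact: subVg|rewrite mulgK].
Qed.

Lemma memoryless_path (v : int -> G) :
  (forall j, edge T H (v j) (v (j + 1)%R)) ->
  exists x, forall j, eqm H (v j) (iterz T j x).
Proof.
move=> vE; have [codE _ _] := memH.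
have : markov_shift (allowed T H)
    ((fun j => to_coset H (v j)) : full_shift (cosets H)).
  by move=> j; apply/allowed_edge.
rewrite -codE => -[x _ xv]; exists x => j.
by apply/to_coset_eq; rewrite -[LHS](congr1 (fun s => s j) xv).
Qed.

(** The past of [x] followed by the future of [y] is a path of allowed transitions; at the junction,
    [T (S x) = x] is in the coset of [y]. *)
Lemma memoryless_splicing : splicing T S H.
Proof.
move=> x y xy.
pose v j := match j with Posz n => iter n T y | Negz n => iter n.+1 S x end.
have [|w wv] := @memoryless_path v.
  move=> [n|[|n]].
  - rewrite -PoszD addn1; exists (iter n T y); first exact: eqmxx.
    exact: eqmxx.
  - exists (S x); first exact: eqmxx.
    by rewrite SK.
  - have -> : (Negz n.+1 + 1)%R = Negz n.
      by rewrite !NegzE -[n.+2]addn1 PoszD GRing.opprD GRing.addrNK.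
    exists (iter n.+2 S x); first exact: eqmxx.
    by rewrite iterS SK; apply: eqmxx.
exists w; split=> [[|n]|n]; [|exact: (wv (Negz n))|exact: (wv (Posz n))].
exact: eqm_trans xy (wv (Posz 0)).
Qed.

Lemma compact_orbit_fincov z : compact (closure (orbitz T z)) ->
  fincov H (torbit T S z).
Proof.
move=> /(compact_fincov sH openH); apply: fincovS => _ [n [->|->]];
  apply: subset_closure; first by exists (Posz n).
by case: n => [|n]; [exists (Posz 0)|exists (Negz n)].
Qed.

Lemma dense_approximable : approximable T S H.
Proof.
move=> n x.
pose O m := [set z | forall i, (i <= m)%N -> eqm H (iter i T x) (iter i T z)].
have contTn i : continuous (iter i T).
  elim: i => [|i ih] z; first exact: cvg_id.
  exact: (continuous_comp (ih z) (contT (x := _))).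
have oO m : open (O m).
  elim: m => [|m ih].
    rewrite (_ : O 0%N = [set z | eqm H x z]); first exact: open_eqm.
    apply/seteqP; split=> z /=; first exact: (fun f => f 0%N isT).
    by move=> xz [|i].
  rewrite (_ : O m.+1 = O m `&`
      iter m.+1 T @^-1` [set z | eqm H (iter m.+1 T x) z]).
    by apply: openI => //; apply: open_comp (open_eqm _ openH) => + _.
  apply/seteqP; split=> z /=.
    move=> xz; split; last exact: (xz m.+1 (leqnn _)).
    by move=> i im; apply: xz; apply: leq_trans im _.
  by move=> [xz xzm] i; rewrite leq_eqVlt ltnS => /orP[/eqP->|/xz].
have On : O n !=set0 by exists x => i _; apply: eqmxx.
have [z [Oz cz]] := denseT On (oO n).
by exists z => //; apply: compact_orbit_fincov.
Qed.

Lemma commensurated_lcoset y : fincov H [set h * y | h in H].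
Proof.
apply: compact_fincov => //; apply: continuous_compact compactH.
by apply: continuous_subspaceT; apply: mulr_continuous.
Qed.

Lemma commensurated_image : fincov H [set T h | h in H].
Proof.
apply: compact_fincov => //; apply: continuous_compact compactH.
exact: continuous_subspaceT.
Qed.

End Memoryless.

(** * Local constancy and continuity for shift spaces *)

Section ShiftTopology.

Lemma near_coord (A : choiceType) (s : full_shift A) j :
  \forall u \near s, u j = s j.
Proof.
have := @proj_continuous int (fun=> discrete_topology A) j s.
by move/(_ [set s j]); apply; exact: discrete_set1.
Qed.

Lemma continuous_to_shift (X : topologicalType) (A : choiceType)
    (f : X -> full_shift A) :
  (forall x j, \forall y \near x, f y j = f x j) -> continuous f.
Proof.
move=> fP x; apply/cvg_sup => j; apply/cvg_image.
  by apply/seteqP; split=> // a _; exists (fun=> a).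
move=> B /nbhs_singleton Bx.
exists [set s | B (s j)].
  by have := fP x j; apply: filterS => y /= ->.
apply/seteqP; split=> [_ [s Bs <-] //|a Ba]; by exists (fun=> a).
Qed.

Lemma continuous_to_discrete (X : topologicalType) (A : choiceType)
    (f : X -> discrete_topology A) :
  (forall x, \forall y \near x, f y = f x) -> continuous f.
Proof. by move=> fP x; apply/discrete_cvg; exact: fP. Qed.

Lemma near_sub (X : topologicalType) (A : set X) (x : A) (P : X -> Prop) :
  (\forall u \near set_val x, P u) -> \forall y \near x, P (set_val y).
Proof. by move=> Px; exact: (@initial_continuous A X set_val x). Qed.

Lemma continuous_to_sub (X Y : topologicalType) (A : set X) (f : Y -> A) :
  continuous (fun y => set_val (f y)) -> continuous f.
Proof.
move=> cf; apply/continuousP => _ [B oB <-].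
by rewrite -comp_preimage; move/continuousP: cf; apply.
Qed.

End ShiftTopology.

(** * The conjugacy given by letters and classes modulo [M] *)

Section Conjugacy.
Context {G : topologicalGroupType}.
Variables (T : G -> G) (TM : {morph T : x y / x * y}) (bijT : bijective T).
Let S := 'pinv_id [set: G] T.
Let TK : cancel T S := pinv_idK bijT.
Let SK : cancel S T := pinv_idKV bijT.
Variables H M : set G.
Hypotheses (sH : subgroup H) (sM : subgroup M) (HM : H `<=` M).
Hypothesis MT : forall x, M x <-> M (T x).
Hypothesis memH : memoryless T H.
Variables (m : nat) (t : 'I_m -> G) (a0 : 'I_m).
Hypothesis tH : forall a, [set T h | h in H] (t a).
Hypothesis t_ex : forall x, [set T h | h in H] x -> exists a, eqm H (t a) x.
Hypothesis t_inj : forall a b, eqm H (t a) (t b) -> a = b.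
Variables (r : nat) (sec : G -> G).
Hypothesis thickM : thick T H M r = M.
Hypothesis secP : forall x, eqm H x (sec x).
Hypothesis secE : forall x y, eqm H x y -> sec x = sec y.
Hypothesis secC : forall i x y, (i <= r)%N -> eqm (thick T H M i) x y ->
  chain T H M i ((sec x)^-1 * sec y).
Variable nu : G -> nat.
Hypothesis nuP : forall x y, nu x = nu y <-> eqm M x y.

(* [G/M] is coded by natural numbers in order to obtain a [countType]. *)
Definition classes : set nat := [set nu x | x in [set: G]].
Let P : countType := {n : nat | n \in classes}.

Definition cls (x : G) : P := exist _ (nu x) (mem_set (imageT nu x)).

Definition pick_cls (n : P) : G := xget 1 [set x | nu x = val n].

Lemma cls_eq x y : cls x = cls y <-> eqm M x y.
Proof.
by split=> [/(congr1 val)/= /nuP //|/nuP xy]; apply: val_inj.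
Qed.

Lemma pick_clsK : cancel pick_cls cls.
Proof.
move=> n; apply: val_inj => /=.
apply: (@xgetPex _ 1 [set x | nu x = val n]).
by have /set_mem[x _ nx] := valP n; exists x.
Qed.

Lemma cls_pick x : eqm M (pick_cls (cls x)) x.
Proof. by apply/cls_eq; rewrite pick_clsK. Qed.

Lemma eqm_iterz j x y : eqm M x y -> eqm M (iterz T j x) (iterz T j y).
Proof.
have SMo := autMV TM TK SK.
have MS x' : M x' -> M (S x') by move=> Mx; apply/MT; rewrite SK.
have iterT n u : M u -> M (iter n T u) by elim: n => // n ih /ih /MT.
have iterS n u : M u -> M (iter n S u) by elim: n => // n ih /ih /MS.
case: j => n xy; rewrite /eqm.
  by rewrite -[(_)^-1](iter_autV TM) -[_ * _](iter_autM TM); apply: iterT.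
by rewrite -[(_)^-1](iter_autV SMo) -[_ * _](iter_autM SMo); apply: iterS.
Qed.

Definition cls_perm (n : P) : P := cls (T (pick_cls n)).

Lemma cls_permE x : cls_perm (cls x) = cls (T x).
Proof. by apply/cls_eq; exact: (eqm_iterz 1 (cls_pick x)). Qed.

Lemma cls_perm_bij : bijective cls_perm.
Proof.
exists (fun n => cls (S (pick_cls n))) => n.
  rewrite -[RHS]pick_clsK; apply/cls_eq.
  by rewrite -[X in eqm _ _ X]TK; exact: (eqm_iterz (Negz 0) (cls_pick _)).
by rewrite cls_permE SK pick_clsK.
Qed.

Lemma iterz_cls_perm j x : iterz cls_perm j (cls x) = cls (iterz T j x).
Proof.
case: j => n; rewrite /iterz.
  by elim: n => //= n ->; rewrite cls_permE.
elim: n.+1 => // k; rewrite !iterS => ->.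
apply: (bij_inj cls_perm_bij).
by rewrite (pinv_idKV cls_perm_bij) cls_permE SK.
Qed.

Lemma finite_cls_orbit x : fincov H (torbit T S x) ->
  finite_set (orbitz cls_perm (cls x)).
Proof.
move=> [s sP]; apply: (@sub_finite_set _ _ [set cls y | y in [set` s]]).
  move=> _ [j _ <-]; rewrite iterz_cls_perm.
  have [|y ys /HM yx] := sP (iterz T j x).
    by case: j => n; [exists n; left|exists n.+1; right].
  by exists y => //; apply/cls_eq.
exact/finite_image/finite_seq.
Qed.

Definition rep (c : cosets H) : G := xget 1 (set_val c).

Lemma repP x : eqm H x (rep (to_coset H x)).
Proof.
have : lcoset H x (rep (to_coset H x)).
  apply: (@xgetPex _ 1 (lcoset H x)); exists x; exists 1; first exact: sub1g.
  by rewrite mulg1.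
by move=> [h Hh <-]; apply: eqm_mulr.
Qed.

Local Notation ltr := (letter T H t a0 sec).
Local Notation fol := (follow T t sec).
Local Open Scope ring_scope.

Definition encode (s : coded_shift T H) : full_shift 'I_m * discrete_topology P :=
  (fun j => ltr (rep (set_val s j)) (rep (set_val s (j + 1))),
   cls (rep (set_val s 0))).

(** The class at time [0], transported to time [j - r], and the [r] letters before time [j]
    determine the coset at time [j]. *)
Definition letter_path (z : full_shift 'I_m * discrete_topology P) (j : int) : G :=
  run T t sec (iterz T (j - r%:Z) (pick_cls z.2))
    (fun i => z.1 (j - r%:Z + i%:Z)) r.

(** Both sides read the same [r] letters, those before time [j + 1], from starts that are equivalent
    modulo [M]; [run_sync] identifies them. *)
Lemma letter_path_follow z j : eqm H (fol (letter_path z j) (z.1 j)) (letter_path z (j + 1)).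
Proof.
have -> : fol (letter_path z j) (z.1 j) =
    run T t sec (iterz T (j - r%:Z) (pick_cls z.2))
    (fun i => z.1 (j - r%:Z + i%:Z)) r.+1.
  by rewrite /= GRing.subrK.
rewrite run_shift /letter_path.
have -> : (fun i => z.1 (j - r%:Z + i.+1%:Z)) =
    (fun i => z.1 (j + 1 - r%:Z + i%:Z)).
  by apply/funext => i; rewrite intS GRing.addrA [j + 1 - _]GRing.addrAC.
apply: (run_sync TM sH sM HM MT tH thickM secC).
apply: (eqm_sym sM); rewrite [j + 1 - _]GRing.addrAC (iterzSr bijT).
exact: (follow_M TM sM HM MT tH secP).
Qed.

Lemma letter_path_edge z j : edge T H (letter_path z j) (letter_path z (j + 1)).
Proof.
have [y xy yz] := edge_follow TM sH tH secP (letter_path z j) (z.1 j).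
by exists y => //; apply: eqm_trans yz (letter_path_follow z j).
Qed.

Definition letter_path_shift z : full_shift (cosets H) :=
  fun j => to_coset H (letter_path z j).

Lemma letter_path_coded z : letter_path_shift z \in coded_shift T H.
Proof.
have [codE _ _] := memH; rewrite codE inE => j.
exact/(allowed_edge T sH)/letter_path_edge.
Qed.

Definition decode z : coded_shift T H := 
  exist (fun s => s \in coded_shift T H) (letter_path_shift z) (letter_path_coded z).

Lemma edge_eqm x x' y y' : eqm H x x' -> eqm H y y' ->
  edge T H x y -> edge T H x' y'.
Proof.
move=> xx' yy' [z xz zy]; exists z; last exact: eqm_trans zy yy'.
by apply: eqm_trans xz => //; apply: eqm_sym.
Qed.

Lemma run_itinerary x (s : nat -> G) : eqm H x (s 0%N) ->
  (forall i, edge T H (s i) (s i.+1)) ->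
  forall i, eqm H (s i) (run T t sec x (fun i => ltr (s i) (s i.+1)) i).
Proof.
move=> xs sE; elim=> [|i ih] /=; first exact: eqm_sym.
have -> : fol (run T t sec x (fun i => ltr (s i) (s i.+1)) i) (ltr (s i) (s i.+1))
  = fol (s i) (ltr (s i) (s i.+1)) by rewrite /follow (secE ih).
by apply: eqm_sym => //; apply: (letterP TM sH a0 t_ex secP (sE i)).
Qed.

(** An itinerary started at time [j - r] is retraced by its own letters; [run_sync] then replaces
    its start by the one used in [letter_path]. *)
Lemma encodeK : cancel encode decode.
Proof.
move=> s; apply: val_inj; apply/funext => j /=.
have /set_mem[x _ xs] := valP s.
have sj i : set_val s i = to_coset H (iterz T i x).
  exact: (esym (congr1 (fun w => w i) xs)).
rewrite -[RHS]/(set_val s j) sj; apply/(to_coset_eq sH).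
pose u (i : nat) := rep (set_val s (j - r%:Z + i%:Z)).
have uE i : eqm H (iterz T (j - r%:Z + i%:Z) x) (u i) by rewrite /u sj; apply: repP.
have edge_u i : edge T H (u i) (u i.+1).
  apply: edge_eqm (uE i) (uE i.+1) _.
  exists (iterz T (j - r%:Z + i%:Z) x); first exact: eqmxx.
  by rewrite intS [1 + _]GRing.addrC GRing.addrA (iterzSr bijT); apply: eqmxx.
have := run_itinerary (eqmxx _ sH) edge_u r => ur.
have := uE r; rewrite GRing.subrK => /(eqm_trans sH) -/(_ _ ur) xr.
apply: eqm_sym => //; apply: eqm_trans xr _ => //.
rewrite /letter_path.
have -> : (fun i => (encode s).1 (j - r%:Z + i%:Z)) =
    (fun i => ltr (u i) (u i.+1)).
  by apply/funext => i; rewrite /= /u intS [1 + _]GRing.addrC GRing.addrA.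
apply: (run_sync TM sH sM HM MT tH thickM secC).
apply: (eqm_sym sM); apply: (eqm_trans sM (y := iterz T (j - r%:Z) x)).
  apply: eqm_iterz; apply: (eqm_trans sM (cls_pick _)).
  by apply/(eqm_sym sM)/HM; rewrite sj; apply: repP.
by apply/HM; have := uE 0%N; rewrite GRing.addr0.
Qed.

(** Letters are recovered since an edge determines its label, and the class since each step of a run
    acts on [G/M] as [T] does. *)
Lemma decodeK : cancel decode encode.
Proof.
move=> [a n]; congr pair.
  apply/funext => j /=; apply: (letter_follow sH _ t_inj).
  have pr i : eqm H (letter_path (a, n) i) (rep (to_coset H (letter_path (a, n) i))).
    exact: repP.
  apply: (eqm_trans sH _ (pr _)).
  have -> : fol (rep (to_coset H (letter_path (a, n) j))) (a j) =
      fol (letter_path (a, n) j) (a j).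
    by rewrite /follow (secE (pr j)).
  exact: (letter_path_follow (a, n)).
rewrite /= -[RHS]pick_clsK; apply/cls_eq.
apply: (eqm_trans sM (y := letter_path (a, n) 0)).
  by apply/(eqm_sym sM)/HM/repP.
rewrite /letter_path; apply: (eqm_sym sM).
have := run_M TM sM HM MT tH secP (iterz T (0 - r%:Z) (pick_cls n))
  (fun i => a (0 - r%:Z + i%:Z)) r.
by rewrite -(iterzD bijT) GRing.subrK.
Qed.

Lemma encode_shift s : encode (coded_map T H bijT s) =
  (shiftz (encode s).1, cls_perm (encode s).2).
Proof.
congr pair; rewrite /= cls_permE; apply/cls_eq.
have /set_mem[x _ xs] := valP s.
have sj i : set_val s i = to_coset H (iterz T i x).
  exact: (esym (congr1 (fun w => w i) xs)).
rewrite sj -[set_val (coded_map _ _ _ _) _]/(set_val s (0 + 1)) sj.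
apply: (eqm_trans sM (y := iterz T (0 + 1) x)).
  by apply: (eqm_sym sM); apply/HM; exact: repP.
rewrite (iterzSr bijT).
exact: (eqm_iterz 1 (HM (repP x))).
Qed.

Lemma encode_continuous : continuous encode.
Proof.
have c1 : continuous (fun s => (encode s).1).
  apply: continuous_to_shift => s j.
  have s0 := near_sub (near_coord (set_val s) j).
  have s1 := near_sub (near_coord (set_val s) (j + 1)).
  by apply: filterS2 s0 s1 => y /= -> ->.
have c2 : continuous (fun s => (encode s).2).
  apply: continuous_to_discrete => s.
  by apply: filterS (near_sub (near_coord (set_val s) 0)) => y /= ->.
move=> s; exact: (cvg_pair (c1 s) (c2 s)).
Qed.

Lemma decode_continuous : continuous decode.
Proof.
apply: continuous_to_sub; apply: continuous_to_shift => z j /=.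
suff : \forall y \near z, letter_path y j = letter_path z j.
  by apply: filterS => y yz; congr to_coset.
have nz2 : \forall y \near z, y.2 = z.2.
  have : (fun y => y.2) @ z --> z.2 by exact: cvg_snd.
  by move/(_ [set z.2]); apply; exact: discrete_set1.
have nz1 i : \forall y \near z, y.1 i = z.1 i.
  have : (fun y => y.1) @ z --> z.1 by exact: cvg_fst.
  by move=> /(_ _ (near_coord z.1 i)).
rewrite /letter_path; set d := j - r%:Z.
suff : forall k, \forall y \near z,
    run T t sec (iterz T d (pick_cls y.2)) (fun i => y.1 (d + i%:Z)) k =
    run T t sec (iterz T d (pick_cls z.2)) (fun i => z.1 (d + i%:Z)) k.
  exact.
elim=> [|k ih]; first by apply: filterS nz2 => y ->.
by apply: filterS2 ih (nz1 (d + k%:Z)) => y /= -> ->.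
Qed.

Lemma coded_conjugate : topologically_conjugate (coded_map T H bijT)
  (fun z : full_shift 'I_m * discrete_topology P => (shiftz z.1, cls_perm z.2)).
Proof.
exists encode, decode; split.
- exact: encodeK.
- exact: decodeK.
- exact: encode_continuous.
- exact: decode_continuous.
- exact: encode_shift.
Qed.

End Conjugacy.

(** * Scale one from an invariant compact open subgroup *)

Section InvariantScale.
Context {G : topologicalGroupType}.

Lemma fincov_compact (H M : set G) : subgroup H -> subgroup M -> H `<=` M ->
  compact H -> fincov H M -> compact M.
Proof.
move=> sH sM HM cH fHM; have [k [t [tM t_ex _]]] := fincov_reps sH fHM.
have -> : M = \big[setU/set0]_(a <- enum 'I_k) lcoset H (t a).
  rewrite -bigcup_seq; apply/seteqP; split=> [x /t_ex[a /eqmP[h Hh ->]]|].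
    by exists a; [rewrite /= mem_enum|exists h].
  by move=> x [a _ [h /HM Mh <-]]; apply: subMg.
apply: bigsetU_compact => a _; apply: continuous_compact cH.
exact/continuous_subspaceT/mull_continuous.
Qed.

Lemma open_supgroup (H M : set G) : subgroup H -> subgroup M -> H `<=` M ->
  open H -> open M.
Proof.
move=> sH sM HM oH; rewrite openE => x Mx.
apply: filterS (open_nbhs_nbhs (conj (open_eqm x oH) (eqmxx x sH))) => y.
exact: eqm_mem.
Qed.

Lemma index_eqxx (M : set G) : subgroup M -> index_eq M M 1%N.
Proof.
move=> sM; rewrite /index_eq.
have -> : [set lcoset M x | x in M] = [set M]; last exact: card_set1.
have cosetM x : M x -> lcoset M x = M.
  move=> Mx; apply/seteqP; split=> [_ [y My <-]|y My]; first exact: (subMg sM).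
  by exists (x^-1 * y); [exact: (subMg sM (subVg sM Mx))|rewrite mulVKg].
apply/seteqP; split=> [_ [x Mx <-]|_ ->]; first exact: cosetM.
by exists 1; [exact: sub1g|exact: (cosetM _ (sub1g sM))].
Qed.

(** [M] realises the index 1, and no index is 0 because the coset of [T 1] is always counted. *)
Lemma scale_invariant (T : G -> G) (M : set G) : subgroup M -> compact M ->
  open M -> T @` M = M -> scale T = 1%N.
Proof.
move=> sM cM oM TM.
have d1 : displacement_index T 1%N.
  by exists M; split=> //; rewrite TM setIid; apply: index_eqxx.
have d_gt0 n : displacement_index T n -> (0 < n)%N.
  case: n => // -[L [sL _ _]]; rewrite /index_eq II0 card_eq0 => /eqP.
  move=> K0; suff : @set0 (set G) (lcoset (T @` L `&` L) (T 1)) by [].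
  by rewrite -K0; exists (T 1) => //; exists 1 => //; apply: sub1g.
apply: get_unique; first by split=> // n /d_gt0.
by move=> n [dn /(_ _ d1) n1]; apply/eqP; rewrite eqn_leq n1 d_gt0.
Qed.

End InvariantScale.

(** One point is chosen in each coset of [M], and the number of its [H]-coset in the countable [G/H]
    serves as code. *)
Lemma class_code (G : topologicalGroupType) (H M : set G) : subgroup H ->
  subgroup M -> H `<=` M -> countable [set: cosets H] ->
  exists nu : G -> nat, forall x y, nu x = nu y <-> eqm M x y.
Proof.
move=> sH sM HM /countable_injP[f finj].
pose s x := xget 1 [set y | eqm M x y].
have sP x : eqm M x (s x).
  by apply: (@xgetPex _ 1 [set y | eqm M x y]); exists x; apply: eqmxx.
exists (fun x => f (to_coset H (s x))) => x y; split.
  move=> /finj; rewrite !inE => /(_ I I) /(to_coset_eq sH)/HM sxy.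
  apply: (eqm_trans sM (sP x)); apply: (eqm_trans sM sxy).
  exact: eqm_sym (sP y).
move=> xy; congr (f (to_coset H _)); congr xget.
apply/seteqP; split=> z; apply: eqm_trans => //; exact: eqm_sym.
Qed.

Theorem mainTheorem3 (G : topologicalGroupType)
    (secG : @second_countable G)
    (hausG : hausdorff_space G)
    (lcG : locally_compact [set: G])
    (tdG : totally_disconnected [set: G])
    (T : G -> G)
    (morphT : {morph T : x y / (x * y)%g})
    (bijT : bijective T)
    (contT : continuous T)
    (H : set G)
    (subH : subgroup H)
    (compactH : compact H)
    (openH : open H)
    (memH : memoryless T H)
    (denseT : dense [set x : G | compact (closure (orbitz T x))]) :
  (exists (A : finType) (P : countType) (p : P -> P),
      [/\ bijective p,
          (forall a : P, finite_set (orbitz p a)) &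
          topologically_conjugate
            (coded_map T H bijT)
            (fun z : full_shift A * discrete_topology P =>
               (shiftz z.1, p z.2))]) /\
  scale T = 1%N.
Proof.
have TK := pinv_idK bijT; have SK := pinv_idKV bijT.
have approxH := dense_approximable contT subH openH denseT.
have fincovT := commensurated_image contT subH compactH openH.
have [M [sM HM fHM MT enterM]] := invariant_subgroup morphT TK SK subH
  (commensurated_lcoset subH compactH openH) fincovT
  (memoryless_splicing bijT subH memH) approxH.
have TM : T @` M = M.
  apply/seteqP; split=> [_ [x Mx <-]|x Mx]; first exact: (MT x).1.
  by exists ('pinv_id [set: G] T x); rewrite ?SK //; apply: (MT _).2; rewrite SK.
split; last first.
  apply: scale_invariant TM => //; first exact: fincov_compact fHM.
  exact: open_supgroup openH.
have [_ _ countH] := memH.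
have [nu nuP] := class_code subH sM HM countH.
have [r thickM] := thick_top morphT TK SK subH sM HM fHM MT enterM.
have [sec [secP secE secC]] := coherent_section morphT subH sM HM MT thickM.
have [m [t [tH t_ex t_inj]]] := fincov_reps subH fincovT.
(* The alphabet is nonempty; this letter is the default value in [letter]. *)
have [a0 _] : exists a, eqm H (t a) (T 1).
  by apply: t_ex; exists 1%g => //; apply: sub1g.
exists 'I_m, {n : nat | n \in classes nu}, (@cls_perm G T nu); split.
- exact: (cls_perm_bij morphT bijT MT nuP).
- move=> a; rewrite -(pick_clsK a).
  (* Already the [H]-coset of the chosen representative contains a bounded point, whose class has a
     finite orbit. *)
  have [z fz xz] := approxH 0%N (pick_cls a).
  have -> : cls nu (pick_cls a) = cls nu z.
    by apply/(cls_eq nuP)/HM; exact: (xz 0%N).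
  exact: (finite_cls_orbit morphT bijT HM MT nuP fz).
- exact: (coded_conjugate morphT bijT subH sM HM MT memH a0 tH t_ex t_inj
    thickM secP secE secC nuP).
Qed.
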